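(* Let $\mathfrak{g}_{2|2}^{2}$ be the complex Lie superalgebra of dimension $2|2$ with basis $\{e_1,e_2\mid e_3,e_4\}$ ($e_1,e_2$ even, $e_3,e_4$ odd) and nontrivial brackets $$[e_3,e_4]=e_1,\quad [e_2,e_3]=e_3,\quad [e_2,e_4]=-e_4.$$ Then $\mathfrak{g}_{2|2}^{2}$ only has trivial metric deformations, i.e. every metric deformation of $\mathfrak{g}_{2|2}^{2}$ is trivial.
   Context: All Lie superalgebras are over $\mathbb{C}$. Brackets of basis elements that are not listed are zero or determined by $[y,x]=-(-1)^{|x||y|}[x,y]$. A metric Lie superalgebra is a Lie superalgebra together with an even, non-degenerate, supersymmetric bilinear form $B$ that is invariant: $B([x,y],z)=B(x,[y,z])$. A formal 1-parameter deformation of a Lie superalgebra $(\mathfrak g,[\ ,\ ])$ is a $\mathbb{C}[[t]]$-bilinear Lie superalgebra structure on $\mathfrak g[[t]]=\mathfrak g\otimes_{\mathbb C}\mathbb{C}[[t]]$ of the form $[\ ,\ ]_t=[\ ,\ ]+\sum_{i\ge1}t^i\phi_i$, each $\phi_i:\mathfrak g\times\mathfrak g\to\mathfrak g$ being an even super-skew-symmetric bilinear map. Two such deformations $[\ ,\ ]_t,[\ ,\ ]'_t$ are equivalent if there is $\widehat\psi_t=\mathrm{id}+\psi_1t+\psi_2t^2+\cdots$ with even linear $\psi_i:\mathfrak g\to\mathfrak g$ and $\widehat\psi_t([x,y]_t)=[\widehat\psi_t(x),\widehat\psi_t(y)]'_t$ for all $x,y\in\mathfrak g$. A deformation is trivial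 if it is equivalent to the original bracket. A metric deformation is a formal 1-parameter deformation that defines a metric Lie superalgebra, i.e. $(\mathfrak g[[t]],[\ ,\ ]_t)$ admits an even, supersymmetric, invariant $\mathbb{C}[[t]]$-bilinear form that is non-degenerate over $\mathbb{C}[[t]]$ (induces an isomorphism with the dual module). *)

(* Defs.v *)
From HB Require Import structures.
From mathcomp Require Import all_boot all_order all_algebra.
From mathcomp Require Import sesquilinear ring boolp reals complex.

Set Implicit Arguments.
Unset Strict Implicit.
Unset Printing Implicit Defensive.

Import GRing.Theory.
Local Open Scope ring_scope.

(* [fps V] is V[[t]].  It is a ring when V = K is a commutative ring, and a   *)
(* K[[t]]-module when V is a K-module; when V is free of finite rank over K,  *)
(* V[[t]] is V (x)_K K[[t]].                                                  *)
Record fps (V : Type) : Type := Fps { fps_coef :> nat -> V }.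

HB.instance Definition _ (V : Type) := gen_eqMixin (fps V).
HB.instance Definition _ (V : Type) := gen_choiceMixin (fps V).

Lemma fpsP (V : Type) (x y : fps V) : (forall n, x n = y n) <-> x = y.
Proof.
split=> [|->//]; case: x y => [x] [y] /= xy.
by congr Fps; apply/funext.
Qed.

Section FpsZmodule.
Variable V : zmodType.
Implicit Types x y z : fps V.

Definition fps_zero : fps V := Fps (fun=> 0).
Definition fps_opp x : fps V := Fps (fun n => - x n).
Definition fps_add x y : fps V := Fps (fun n => x n + y n).

Fact fps_addA : associative fps_add.
Proof. by move=> x y z; apply/fpsP => n /=; rewrite addrA. Qed.
Fact fps_addC : commutative fps_add.
Proof. by move=> x y; apply/fpsP => n /=; rewrite addrC. Qed.
Fact fps_add0 : left_id fps_zero fps_add.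
Proof. by move=> x; apply/fpsP => n /=; rewrite add0r. Qed.
Fact fps_addN : left_inverse fps_zero fps_opp fps_add.
Proof. by move=> x; apply/fpsP => n /=; rewrite addNr. Qed.

HB.instance Definition _ := GRing.isZmodule.Build (fps V)
  fps_addA fps_addC fps_add0 fps_addN.

Definition fpsC (v : V) : fps V := Fps (fun n => if n is 0 then v else 0).
End FpsZmodule.

Lemma sum_triangle (V : nmodType) (F : nat -> nat -> nat -> V) n :
  \sum_(i < n.+1) \sum_(j < i.+1) F j (i - j)%N (n - i)%N =
  \sum_(j < n.+1) \sum_(k < (n - j).+1) F j k (n - j - k)%N.
Proof.
transitivity (\sum_(i < n.+1) \sum_(j < n.+1 | (j < i.+1)%N)
                F j (i - j)%N (n - i)%N).
  apply: eq_bigr => i _.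
  by rewrite (big_ord_widen n.+1 (fun j => F j (i - j)%N (n - i)%N)).
rewrite (exchange_big_dep xpredT) //=; apply: eq_bigr => j _.
rewrite -(big_mkord (fun i => j < i.+1)%N
            (fun i => F j (i - j)%N (n - i)%N)).
rewrite -(big_mkord xpredT (fun k => F j k (n - j - k)%N)).
rewrite -(big_nat_widenl j 0 _ xpredT) // -{1}[nat_of_ord j]add0n big_addn subSn.
  by apply: eq_bigr => k _; rewrite addnK addnC subnDA.
by rewrite -ltnS.
Qed.

Section FpsCauchy.
Variables (K : comNzRingType) (V : lmodType K).

Definition fps_scale (a : fps K) (x : fps V) : fps V :=
  Fps (fun n => \sum_(i < n.+1) a i *: x (n - i)%N).

Lemma fps_scaleA (a b : fps K) (x : fps V) :
  fps_scale a (fps_scale b x) =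
  fps_scale (Fps (fun n => \sum_(i < n.+1) a i * b (n - i)%N)) x.
Proof.
apply/fpsP => n /=.
transitivity (\sum_(i < n.+1) \sum_(j < i.+1)
                (a j * b (i - j)%N) *: x (n - i)%N); last first.
  by apply: eq_bigr => i _; rewrite scaler_suml.
rewrite (sum_triangle (fun j k l => (a j * b k) *: x l)).
apply: eq_bigr => i _; rewrite scaler_sumr.
by apply: eq_bigr => j _; rewrite scalerA.
Qed.

Lemma fps_scale1 : left_id (fpsC 1) fps_scale.
Proof.
move=> x; apply/fpsP => n /=; rewrite big_ord_recl /= scale1r subn0.
by rewrite big1 ?addr0 // => i _; rewrite scale0r.
Qed.

Lemma fps_scaleDr : right_distributive fps_scale +%R.
Proof.
move=> a x y; apply/fpsP => n /=; rewrite -big_split.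
by apply: eq_bigr => i _; rewrite scalerDr.
Qed.

Lemma fps_scaleDl (x : fps V) : {morph fps_scale^~ x : a b / a + b}.
Proof.
move=> a b; apply/fpsP => n /=; rewrite -big_split.
by apply: eq_bigr => i _; rewrite scalerDl.
Qed.
End FpsCauchy.

Section FpsRing.
Variable K : comNzRingType.

Definition fps_mul (a b : fps K) : fps K :=
  Fps (fun n => \sum_(i < n.+1) a i * b (n - i)%N).

Fact fps_mulA : associative fps_mul.
Proof. by move=> a b c; exact: (@fps_scaleA K K^o). Qed.
Fact fps_mulC : commutative fps_mul.
Proof.
move=> a b; apply/fpsP => n /=; rewrite (reindex_inj rev_ord_inj) /=.
by apply: eq_bigr => i _; rewrite subSS mulrC subKn // -ltnS.
Qed.
Fact fps_mul1 : left_id (fpsC 1) fps_mul.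
Proof. exact: (@fps_scale1 K K^o). Qed.
Fact fps_mulDl : left_distributive fps_mul +%R.
Proof. by move=> a b c; exact: (@fps_scaleDl K K^o). Qed.
Fact fps_1_neq0 : fpsC 1 != 0 :> fps K.
Proof. by apply/eqP => /fpsP /(_ 0%N) /eqP; rewrite /= oner_eq0. Qed.

HB.instance Definition _ := GRing.Zmodule_isComNzRing.Build (fps K)
  fps_mulA fps_mulC fps_mul1 fps_mulDl fps_1_neq0.
End FpsRing.

Section FpsModule.
Variables (K : comNzRingType) (V : lmodType K).

Fact fps_scale_mul (a b : fps K) (x : fps V) :
  fps_scale a (fps_scale b x) = fps_scale (a * b) x.
Proof. exact: fps_scaleA. Qed.

HB.instance Definition _ := GRing.Zmodule_isLmodule.Build (fps K) (fps V)
  fps_scale_mul (@fps_scale1 K V) (@fps_scaleDr K V) (@fps_scaleDl K V).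
End FpsModule.

(* [gr b x] means that x lies in the component of parity b of a Z/2-graded    *)
(* module, where [false] is even and [true] is odd.                           *)
Section Super.
Variables (K : comNzRingType) (V : lmodType K) (gr : bool -> V -> Prop).

Definition is_grading : Prop :=
  [/\ forall b, gr b 0,
      forall b (a : K) x y, gr b x -> gr b y -> gr b (a *: x + y)
    & forall x, exists! p : V * V,
        [/\ gr false p.1, gr true p.2 & x = p.1 + p.2]].

Definition even_map (f : V -> V) : Prop := forall b x, gr b x -> gr b (f x).

Definition even_bracket (br : V -> V -> V) : Prop :=
  forall a b x y, gr a x -> gr b y -> gr (a (+) b) (br x y).

Definition super_skew (br : V -> V -> V) : Prop :=
  forall a b x y, gr a x -> gr b y ->
    br y x = - ((-1) ^+ (a && b) *: br x y).

Definition super_jacobi (br : V -> V -> V) : Prop :=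
  forall a b c x y z, gr a x -> gr b y -> gr c z ->
    br x (br y z) = br (br x y) z + (-1) ^+ (a && b) *: br y (br x z).

Definition is_lie_superalgebra (br : V -> V -> V) : Prop :=
  [/\ is_grading, bilinear_for *:%R *:%R br, even_bracket br,
      super_skew br & super_jacobi br].

Definition even_form (B : V -> V -> K) : Prop :=
  forall a b x y, gr a x -> gr b y -> a != b -> B x y = 0.

Definition supersymmetric (B : V -> V -> K) : Prop :=
  forall a b x y, gr a x -> gr b y -> B y x = (-1) ^+ (a && b) * B x y.

Definition invariant_form (br : V -> V -> V) (B : V -> V -> K) : Prop :=
  forall x y z, B (br x y) z = B x (br y z).

(* x |-> B x _ is a bijection from V onto its dual module *)
Definition nondegenerate_form (B : V -> V -> K) : Prop :=
  forall f : {scalar V}, exists! x, forall y, B x y = f y.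

Definition is_metric_form (br : V -> V -> V) (B : V -> V -> K) : Prop :=
  [/\ bilinear_for *%R *%R B, even_form B, supersymmetric B,
      invariant_form br B & nondegenerate_form B].

Definition is_metric_lie_superalgebra (br : V -> V -> V) : Prop :=
  is_lie_superalgebra br /\ exists B, is_metric_form br B.
End Super.

Section Deformations.
Variables (K : comNzRingType) (V : lmodType K) (gr : bool -> V -> Prop).

Definition fps_gr (b : bool) (x : fps V) : Prop := forall n, gr b (x n).

(* The K[[t]]-linear extension of \sum_i t^i psi_i. *)
Definition fps_linear (psi : nat -> V -> V) (x : fps V) : fps V :=
  Fps (fun n => \sum_(i < n.+1) psi i (x (n - i)%N)).

(* The K[[t]]-bilinear extension of \sum_i t^i phi_i; it is the only one when *)
(* V is free of finite rank.                                                  *)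
Definition fps_bilinear (phi : nat -> V -> V -> V) (x y : fps V) : fps V :=
  Fps (fun n => \sum_(i < n.+1) \sum_(j < (n - i).+1)
                  phi i (x j) (y (n - i - j)%N)).

(* The deformation [ , ] + \sum_(i >= 1) t^i phi_i is encoded by the family   *)
(* phi, with phi_0 = [ , ].                                                   *)
Definition is_deformation (br : V -> V -> V) (phi : nat -> V -> V -> V) : Prop :=
  [/\ phi 0%N = br,
      forall i, (0 < i)%N ->
        [/\ bilinear_for *:%R *:%R (phi i), even_bracket gr (phi i)
          & super_skew gr (phi i)]
    & is_lie_superalgebra fps_gr (fps_bilinear phi)].

Definition equivalent_deformations (phi phi' : nat -> V -> V -> V) : Prop :=
  exists psi : nat -> V -> V,
    [/\ psi 0%N = id,
        forall i, linear (psi i) /\ even_map gr (psi i)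
      & forall x y : V,
          fps_linear psi (fps_bilinear phi (fpsC x) (fpsC y)) =
          fps_bilinear phi' (fps_linear psi (fpsC x)) (fps_linear psi (fpsC y))].

Definition constant_deformation (br : V -> V -> V) : nat -> V -> V -> V :=
  fun i => if i is 0 then br else fun _ _ => 0.

Definition trivial_deformation (br : V -> V -> V) (phi : nat -> V -> V -> V) :=
  equivalent_deformations phi (constant_deformation br).

Definition is_metric_deformation (br : V -> V -> V)
    (phi : nat -> V -> V -> V) : Prop :=
  is_deformation br phi /\
  is_metric_lie_superalgebra fps_gr (fps_bilinear phi).
End Deformations.

(* The superalgebra g_{2|2}^2 on K^4.  The basis vector e_k, 1 <= k <= 4, has *)
(* its nonzero coordinate at the index k - 1 of 'I_4.                         *)
Section G22.
Variable K : comNzRingType.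

Definition g22_e (k : nat) : 'rV[K]_4 := \row_i (i.+1 == k)%:R.

Definition g22_gr (b : bool) (x : 'rV[K]_4) : Prop :=
  forall i : 'I_4, (2 < i.+1)%N != b -> x 0 i = 0.

Definition g22_table (k l : nat) : 'rV[K]_4 :=
  match k, l with
  | 3, 4 => g22_e 1
  | 4, 3 => g22_e 1
  | 2, 3 => g22_e 3
  | 3, 2 => - g22_e 3
  | 2, 4 => - g22_e 4
  | 4, 2 => g22_e 4
  | _, _ => 0
  end.

Definition g22_br (x y : 'rV[K]_4) : 'rV[K]_4 :=
  \sum_i \sum_j (x 0 i * y 0 j) *: g22_table i.+1 j.+1.

Local Notation V := 'rV[K]_4.

Definition g22_i0 : 'I_4 := @Ordinal 4 0 isT.
Definition g22_i1 : 'I_4 := @Ordinal 4 1 isT.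
Definition g22_i2 : 'I_4 := @Ordinal 4 2 isT.
Definition g22_i3 : 'I_4 := @Ordinal 4 3 isT.

Lemma g22_ordP (P : 'I_4 -> Prop) : P g22_i0 -> P g22_i1 -> P g22_i2 -> P g22_i3 -> forall i, P i.
Proof.
move=> p0 p1 p2 p3 i; have : (i \in [:: g22_i0; g22_i1; g22_i2; g22_i3]) by case: i => [[|[|[|[|//]]]] h].
by rewrite !inE => /or4P[] /eqP ->.
Qed.

Lemma g22_sum (W : nmodType) (F : 'I_4 -> W) : \sum_i F i = F g22_i0 + F g22_i1 + F g22_i2 + F g22_i3.
Proof.
rewrite !big_ord_recl big_ord0 addr0 !addrA.
by congr (F _ + F _ + F _ + F _); apply/val_inj.
Qed.

Lemma g22_brE (x y : V) : g22_br x y =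
   \row_i (match val i with
   | 0 => x 0 g22_i2 * y 0 g22_i3 + x 0 g22_i3 * y 0 g22_i2
   | 1 => 0
   | 2 => x 0 g22_i1 * y 0 g22_i2 - x 0 g22_i2 * y 0 g22_i1
   | _ => - (x 0 g22_i1 * y 0 g22_i3) + x 0 g22_i3 * y 0 g22_i1 end).
Proof.
apply/rowP; rewrite /g22_br.
apply: g22_ordP; rewrite !g22_sum !mxE /=; ring.
Qed.

Lemma g22_rowP (x y : V) :
  x 0 g22_i0 = y 0 g22_i0 -> x 0 g22_i1 = y 0 g22_i1 ->
  x 0 g22_i2 = y 0 g22_i2 -> x 0 g22_i3 = y 0 g22_i3 -> x = y.
Proof. by move=> *; apply/rowP; apply: g22_ordP. Qed.

Lemma g22_grE b (x : V) : g22_gr b x <->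
  if b then x 0 g22_i0 = 0 /\ x 0 g22_i1 = 0
  else x 0 g22_i2 = 0 /\ x 0 g22_i3 = 0.
Proof.
split; first by case: b => h; split; apply: h.
by case: b => -[h1 h2]; apply: g22_ordP.
Qed.

Lemma g22_lie : is_lie_superalgebra g22_gr g22_br.
Proof.
split.
- split.
  + by case; apply/g22_grE; rewrite !mxE.
  + by case=> a x y /g22_grE [h1 h2] /g22_grE [h3 h4]; apply/g22_grE; rewrite !mxE h1 h2 h3 h4 !mulr0 addr0.
  + move=> x.
    exists (\row_i (if (i < 2)%N then x 0 i else 0), \row_i (if (i < 2)%N then 0 else x 0 i)).
    split=> /=.
      split; try by apply/g22_grE; rewrite !mxE.
      by apply: g22_rowP; rewrite !mxE /= ?addr0 ?add0r.
    move=> [p q] /= [/g22_grE [h1 h2] /g22_grE [h3 h4] ->].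
    by congr pair; apply: g22_rowP; rewrite !mxE /= ?h1 ?h2 ?h3 ?h4 ?addr0 ?add0r.
- by split=> u a x y; apply: g22_rowP; rewrite !g22_brE !mxE /=; ring.
- by move=> a b x y /g22_grE hx /g22_grE hy; case: a hx => -[x1 x2]; case: b hy=> -[y1 y2];
  apply/g22_grE; rewrite !g22_brE !mxE /= ?x1 ?x2 ?y1 ?y2; split; ring.
- by move=> a b x y /g22_grE hx /g22_grE hy; case: a hx => -[x1 x2]; case: b hy=> -[y1 y2];
  apply: g22_rowP; rewrite !g22_brE !mxE /= ?x1 ?x2 ?y1 ?y2 ?expr1 ?expr0; ring.
- by move=> a b c x y z /g22_grE hx /g22_grE hy /g22_grE hz; case: a hx => -[x1 x2]; case: b hy=> -[y1 y2];
  case: c hz => -[z1 z2];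
  apply: g22_rowP; rewrite !g22_brE !mxE /= ?x1 ?x2 ?y1 ?y2 ?z1 ?z2 ?expr1 ?expr0; ring.
Qed.
End G22.

(* Main.v *)
(* Over A = K[[t]], put E0, ..., E3 = e_1, ..., e_4 and expand the deformed    *)
(* bracket in this basis.  The metric form forces [E0, E1] = 0 and makes      *)
(* ad E0 and ad E1 traceless on the odd part.  There ad E1 has the matrix     *)
(* (p, q; r, -p) with p a unit, and the Jacobi identity yields                *)
(* ad E0 = rho ad E1, [E2, E3] = w = a (E0 - rho E1), [E2, E2] = - (q / p) w  *)
(* and [E3, E3] = (r / p) w.  Since p^2 + qr = 1 at t = 0, it has a square    *)
(* root l, and diagonalizing ad E1 gives the equivalence                      *)
(*   E0 |-> al E0 + rho l E1,             E1 |-> l E1,                        *)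
(*   E2 |-> ((p + l) E2 - q E3) / 2,      E3 |-> (r E2 + (p + l) E3) / 2,     *)
(* where al = a^-1 p (p + l) / 2, onto the constant bracket.                  *)

From HB Require Import structures.
Require Import Defs.
From mathcomp Require Import all_boot all_order all_algebra reals complex.
From mathcomp Require Import sesquilinear ring boolp.
Set Implicit Arguments.
Unset Strict Implicit.
Unset Printing Implicit Defensive.

Import GRing.Theory Num.Theory.
Local Open Scope ring_scope.

(** The deformed bracket is studied as a Lie superalgebra over A = K[[t]]. The invariant form enters
    only through [even_part_abelian] and [ad_even_traceless]: it forces the even part to be abelian
    and makes it act on the rank 2 odd part by operators of sl(2). At t = 0 the operator ad E1 is
    diag(1, -1), so its entry p is a unit and -det = p^2 + qr has a square root l in A; hence ad E1
    is diagonalizable over A with eigenvalues l and -l. The Jacobi identity then leaves no further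
    freedom: ad E0 is proportional to ad E1 ([ad_proportional]), all odd brackets are multiples of
    [E2, E3] ([odd_squares]), and [E2, E3] is central ([odd_bracket_central]). A change of basis
    that is the identity at t = 0 gives back the original structure constants
    ([normalizing_map]). *)

(** * Inverses and square roots of power series *)

Section PowerSeries.
Variable K : fieldType.
Implicit Types a b : fps K.

Lemma coef0_fpsM a b : (a * b) 0%N = a 0%N * b 0%N.
Proof. by rewrite /= big_ord_recl big_ord0 addr0. Qed.

(** Course-of-values recursion, used to solve power series equations one coefficient at a time. *)
Lemma sequence_by_recursion (T : Type) (F : seq T -> T) :
  exists f : nat -> T, forall n, f n = F (mkseq f n).
Proof.
pose g := fix g n := if n is m.+1 then rcons (g m) (F (g m)) else [::].
have gE n : g n = mkseq (fun k => F (g k)) n.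
  by elim: n => //= n IHn; rewrite mkseqS -IHn.
by exists (fun n => F (g n)) => n; rewrite gE.
Qed.

Lemma fps_inv_exists a : a 0%N = 1 -> exists2 b, a * b = 1 & b 0%N = 1.
Proof.
move=> a0; have [f fE] := sequence_by_recursion
  (fun s => (size s == 0%N)%:R - \sum_(i < size s) a i.+1 * s`_(size s - i.+1)).
have f0 : f 0%N = 1 by rewrite fE /= big_ord0 subr0.
exists (Fps f) => //; apply/fpsP => -[|n]; rewrite /= big_ord_recl a0 mul1r subn0.
  by rewrite big_ord0 addr0.
rewrite [f _]fE size_mkseq sub0r; apply/eqP; rewrite addrC subr_eq0; apply/eqP.
by apply: eq_bigr => i _; rewrite nth_mkseq // subSS ltnS leq_subr.
Qed.

(** In degree n + 1 the equation b^2 = a reads 2 b_(n+1) + (terms in b_1, ..., b_n) = a_(n+1), which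
    determines b_(n+1) once 2 is invertible. *)
Lemma fps_sqrt_exists a : (2 : K) != 0 -> a 0%N = 1 ->
  exists2 b, b * b = a & b 0%N = 1.
Proof.
move=> K2 a0; have [f fE] := sequence_by_recursion
  (fun s => if size s is n.+1 then
     2^-1 * (a n.+1 - \sum_(i < n) s`_i.+1 * s`_(n - i)) else 1).
have f0 : f 0%N = 1 by rewrite fE.
exists (Fps f) => //; apply/fpsP => -[|n]; rewrite /= big_ord_recl /= f0 mul1r.
  by rewrite big_ord0 addr0 a0.
rewrite big_ord_recr /= /bump /= add1n subnn f0 mulr1 addrCA -mulr2n -mulr_natl.
rewrite [f n.+1]fE size_mkseq mulVKf // addrC.
rewrite [X in _ - X](eq_bigr (fun i : 'I_n => f i.+1 * f (n - i)%N)) ?subrK // => i _.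
by rewrite !nth_mkseq ?ltnS ?leq_subr // ltn_ord.
Qed.
End PowerSeries.

(** * Coordinates and bases over K[[t]] *)

Section Coordinates.
Variables (K : comNzRingType) (m : nat).
Local Notation A := (fps K).
Local Notation M := (fps 'rV[K]_m).

Definition coord (i : 'I_m) (X : M) : A := Fps (fun n => X n 0 i).
Definition basis (i : 'I_m) : M := fpsC (delta_mx 0 i).

Lemma coordP (X Y : M) : (forall i, coord i X = coord i Y) -> X = Y.
Proof.
move=> XY; apply/fpsP => n; apply/rowP => i.
by have /fpsP/(_ n) := XY i.
Qed.

Lemma coord_linear i : linear_for *%R (coord i).
Proof.
move=> a X Y; apply/fpsP => n; rewrite /= !mxE summxE; congr (_ + _).
by apply: eq_bigr => j _; rewrite mxE.
Qed.

HB.instance Definition _ i :=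
  GRing.isLinear.Build A M A *%R (coord i) (coord_linear i).

Lemma coordZ i a X : coord i (a *: X) = a * coord i X.
Proof. exact: linearZ_LR. Qed.

Lemma coord_basis i j : coord j (basis i) = (i == j)%:R.
Proof.
by rewrite eq_sym; apply/fpsP => -[|n]; rewrite /= !mxE /=; case: (j == i).
Qed.

Lemma basis_decomp (X : M) : X = \sum_i coord i X *: basis i.
Proof.
apply: coordP => j; rewrite raddf_sum (bigD1 j) //= big1 => [|i ij].
  by rewrite coordZ coord_basis eqxx mulr1 addr0.
by rewrite coordZ coord_basis (negPf ij) mulr0.
Qed.

Lemma bilinear_basis (W : lmodType A) (f : M -> M -> W) (X Y : M) :
  bilinear_for *:%R *:%R f ->
  f X Y = \sum_i \sum_j (coord i X * coord j Y) *: f (basis i) (basis j).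
Proof.
move=> f_bilinear.
pose F := HB.pack_for {bilinear M -> M -> W} f
  (bilinear_isBilinear.Build A M M W *:%R *:%R f f_bilinear).
rewrite -[f]/(F : M -> M -> W) {1}(basis_decomp X) linear_sumlz.
apply: eq_bigr => i _; rewrite linearZl_LR {1}(basis_decomp Y) linear_sumr.
rewrite scaler_sumr; apply: eq_bigr => j _.
by rewrite linearZr_LR scalerA.
Qed.

Lemma biscalar_basis (f : M -> M -> A) (X Y : M) :
  bilinear_for *%R *%R f ->
  f X Y = \sum_i \sum_j (coord i X * coord j Y) * f (basis i) (basis j).
Proof. exact: (@bilinear_basis A^o). Qed.

(** A sequence of matrices over K amounts to a single matrix over K[[t]], acting on row vectors. *)
Lemma fps_linearE (N : nat -> 'M[K]_m) (X : M) i :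
  coord i (fps_linear (fun n v => v *m N n) X) =
  \sum_j coord j X * Fps (fun n => N n j i).
Proof.
rewrite (eq_bigr (fun j => Fps (fun n => N n j i) * coord j X)); last first.
  by move=> j _; rewrite mulrC.
apply/fpsP => n; rewrite /= summxE.
transitivity (\sum_(k < n.+1) \sum_j N k j i * X (n - k)%N 0 j).
  apply: eq_bigr => k _; rewrite mxE; apply: eq_bigr => j _.
  by rewrite mulrC.
rewrite exchange_big /=.
elim/big_ind2: _ => //= [x a y c -> ->] //.
Qed.
End Coordinates.

(** * Constraints imposed by the invariant form *)

Section Metric.
Variable K : numFieldType.
Local Notation A := (fps K).
Local Notation V := 'rV[K]_4.
Local Notation gr := (fps_gr (@g22_gr K)).
Local Notation i0 := g22_i0.
Local Notation i1 := g22_i1.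
Local Notation i2 := g22_i2.
Local Notation i3 := g22_i3.
Local Notation E i := (@basis K 4 i).

Lemma fps_natmulI n (x : A) : x *+ n.+1 = 0 -> x = 0.
Proof.
move=> /fpsP x0; apply/fpsP => k; have /eqP := x0 k.
have -> : (x *+ n.+1) k = x k *+ n.+1.
  by elim: n {x0} => // n IHn; rewrite mulrS /= IHn -mulrS.
by rewrite mulrn_eq0 => /eqP.
Qed.

Lemma fps_eqN (x : A) : x = - x -> x = 0.
Proof.
move=> xN; apply: (@fps_natmulI 1).
by rewrite mulr2n {1}xN addNr.
Qed.

Lemma gr_coord s (X : fps V) (i : 'I_4) : gr s X -> (1 < i)%N != s -> coord i X = 0.
Proof. by move=> Xs si; apply/fpsP => n; apply: (Xs n i). Qed.

Lemma gr_basis (i : 'I_4) : gr (1 < i)%N (E i).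
Proof.
case=> [|n] j ij; rewrite /= !mxE //=.
by case: (j =P i) ij => // ->; rewrite eqxx.
Qed.
Arguments gr_basis : clear implicits.

Lemma coord_rowP (X Y : fps V) :
  coord i0 X = coord i0 Y -> coord i1 X = coord i1 Y ->
  coord i2 X = coord i2 Y -> coord i3 X = coord i3 Y -> X = Y.
Proof. by move=> *; apply: coordP; apply: g22_ordP. Qed.

Section Form.
Variable B : fps V -> fps V -> A.
Hypotheses (B_bilin : bilinear_for *%R *%R B) (B_even : even_form gr B)
  (B_sym : supersymmetric gr B) (B_nondeg : nondegenerate_form B).

Lemma form_parity (i j : 'I_4) : (1 < i)%N != (1 < j)%N -> B (E i) (E j) = 0.
Proof. by apply: B_even; apply: gr_basis. Qed.

(** Evenness removes the mixed entries of the Gram matrix, and supersymmetry makes the odd block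
    alternating. *)
Lemma form_coord X Y :
  B X Y = coord i0 X * coord i0 Y * B (E i0) (E i0)
    + (coord i0 X * coord i1 Y + coord i1 X * coord i0 Y) * B (E i0) (E i1)
    + coord i1 X * coord i1 Y * B (E i1) (E i1)
    + (coord i2 X * coord i3 Y - coord i3 X * coord i2 Y) * B (E i2) (E i3).
Proof.
have B_odd (i : 'I_4) : (1 < i)%N -> B (E i) (E i) = 0.
  move=> oi; apply: fps_eqN.
  by rewrite {1}(B_sym (gr_basis i) (gr_basis i)) oi expr1 mulN1r.
have B32 : B (E i3) (E i2) = - B (E i2) (E i3).
  by rewrite (B_sym (gr_basis i2) (gr_basis i3)) expr1 mulN1r.
have B10 : B (E i1) (E i0) = B (E i0) (E i1).
  by rewrite (B_sym (gr_basis i0) (gr_basis i1)) expr0 mul1r.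
rewrite (biscalar_basis _ _ B_bilin) !g22_sum B32 B10 !(B_odd i2) ?(B_odd i3) //.
rewrite !(form_parity (i := i0) (j := i2), form_parity (i := i0) (j := i3)) //.
rewrite !(form_parity (i := i1) (j := i2), form_parity (i := i1) (j := i3)) //.
rewrite !(form_parity (i := i2) (j := i0), form_parity (i := i3) (j := i0)) //.
rewrite !(form_parity (i := i2) (j := i1), form_parity (i := i3) (j := i1)) //.
ring.
Qed.

Lemma form_ker X : (forall Y, B X Y = 0) -> X = 0.
Proof.
move=> BX0; have [Z [_ Zuniq]] := B_nondeg \0.
rewrite -(Zuniq X BX0); apply: Zuniq => Y.
by rewrite form_coord !raddf0 /=; ring.
Qed.

Section Bracket.
Variable br : fps V -> fps V -> fps V.
Hypotheses (br_even : even_bracket gr br) (br_skew : super_skew gr br)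
  (B_inv : invariant_form br B).

Lemma bracket_parity (i j k : 'I_4) :
  (1 < k)%N != (1 < i)%N (+) (1 < j)%N -> coord k (br (E i) (E j)) = 0.
Proof. by apply: gr_coord; apply: br_even; apply: gr_basis. Qed.

Lemma bracket_basis_skew (i j : 'I_4) :
  br (E j) (E i) = - ((-1) ^+ ((1 < i)%N && (1 < j)%N) *: br (E i) (E j)).
Proof. by apply: br_skew; apply: gr_basis. Qed.

Lemma bracket_even_diag (i : 'I_4) : (i < 2)%N -> br (E i) (E i) = 0.
Proof.
rewrite ltnS leqNgt => /negbTE oi; apply: coordP => k; rewrite raddf0; apply: fps_eqN.
by rewrite {1}bracket_basis_skew oi expr0 scale1r raddfN.
Qed.

(* [E0, E1] is orthogonal to E0 and E1 by invariance and to the odd part by   *)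
(* parity, hence zero.                                                        *)
Lemma even_part_abelian : br (E i0) (E i1) = 0.
Proof.
have sub0 : forall X : fps V, B X 0 = 0.
  by move=> X; rewrite form_coord !raddf0; ring.
have B0 : B (br (E i0) (E i1)) (E i0) = 0.
  have ev : gr false (br (E i1) (E i0)).
    exact: (br_even (gr_basis i1) (gr_basis i0)).
  rewrite B_inv (B_sym ev (gr_basis i0)) expr0 mul1r B_inv.
  by rewrite bracket_even_diag // sub0.
have B1 : B (br (E i0) (E i1)) (E i1) = 0.
  by rewrite B_inv bracket_even_diag // sub0.
apply: form_ker => Y; set Z := br _ _ in B0 B1 *.
have -> : B Z Y = coord i0 Y * B Z (E i0) + coord i1 Y * B Z (E i1).
  rewrite !(form_coord Z) !coord_basis !(@bracket_parity i0 i1 i2) //.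
  by rewrite !(@bracket_parity i0 i1 i3) //=; ring.
by rewrite B0 B1 !mulr0 addr0.
Qed.

(** By invariance ad E_i preserves the form on the odd part, which is symplectic of rank 2, and
    sp(2) = sl(2). *)
Lemma ad_even_traceless (i : 'I_4) : (i < 2)%N ->
  coord i3 (br (E i) (E i3)) = - coord i2 (br (E i) (E i2)).
Proof.
rewrite ltnS leqNgt => /negbTE oi.
have := B_inv (E i2) (E i) (E i3).
rewrite (bracket_basis_skew i i2) oi andFb expr0 scale1r.
rewrite (form_coord (- _)) (form_coord _ (br _ _)) !raddfN !coord_basis /=.
rewrite !(@bracket_parity i i2 i0) ?(@bracket_parity i i2 i1) ?oi //.
rewrite ?(@bracket_parity i i3 i0) ?(@bracket_parity i i3 i1) ?oi // => tr0.
set c := coord i3 (br (E i) (E i3)) in tr0 *.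
set d := coord i2 (br (E i) (E i2)) in tr0 *.
have cd0 : (c + d) * B (E i2) (E i3) = 0.
  by move/esym/eqP: tr0; rewrite -subr_eq0 => /eqP <-; ring.
(* Instead of cancelling B(E2, E3), the vector (c + d) E2 is shown to lie in the kernel of the
   form. *)
suff : (c + d) *: E i2 = 0.
  move=> /(congr1 (coord i2)); rewrite coordZ coord_basis raddf0 eqxx mulr1.
  by move=> /eqP; rewrite addr_eq0 => /eqP.
apply: form_ker => Y; rewrite form_coord !coordZ !coord_basis /=.
transitivity (coord i3 Y * ((c + d) * B (E i2) (E i3))); first by ring.
by rewrite cd0 mulr0.
Qed.
End Bracket.
End Form.
End Metric.

Arguments gr_basis : clear implicits.

(** * Normal form of the bracket from the Jacobi identity *)

Section Normalization.
Variable K : numFieldType.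
Local Notation A := (fps K).
Local Notation V := 'rV[K]_4.
Local Notation gr := (fps_gr (@g22_gr K)).
Local Notation i0 := g22_i0.
Local Notation i1 := g22_i1.
Local Notation i2 := g22_i2.
Local Notation i3 := g22_i3.
Local Notation E i := (@basis K 4 i).

Lemma constant_bracket_coord (X Y : fps V) :
  let Z := fps_bilinear (constant_deformation (@g22_br K)) X Y in
  [/\ coord i0 Z = coord i2 X * coord i3 Y + coord i3 X * coord i2 Y,
      coord i1 Z = 0,
      coord i2 Z = coord i1 X * coord i2 Y - coord i2 X * coord i1 Y
    & coord i3 Z = - (coord i1 X * coord i3 Y) + coord i3 X * coord i1 Y].
Proof.
have ZE k : coord k (fps_bilinear (constant_deformation (@g22_br K)) X Y) =
    Fps (fun n => \sum_(j < n.+1) g22_br (X j) (Y (n - j)%N) 0 k).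
  apply/fpsP => n; rewrite /= big_ord_recl subn0 [X in _ + X]big1 ?addr0.
    by rewrite summxE.
  by move=> j _; rewrite big1.
split; rewrite ZE; apply/fpsP => n /=.
- by rewrite -big_split; apply: eq_bigr => j _; rewrite g22_brE mxE.
- by rewrite big1 // => j _; rewrite g22_brE mxE.
- by rewrite -sumrN -big_split; apply: eq_bigr => j _; rewrite g22_brE mxE.
by rewrite -sumrN -big_split; apply: eq_bigr => j _; rewrite g22_brE mxE.
Qed.

Section Bracket.
Variable br : fps V -> fps V -> fps V.
Hypotheses (br_bilin : bilinear_for *:%R *:%R br) (br_even : even_bracket gr br)
  (br_skew : super_skew gr br) (br_jacobi : super_jacobi gr br).
Hypotheses (br_even_part : br (E i0) (E i1) = 0)
  (br_trace : forall i : 'I_4, (i < 2)%N ->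
     coord i3 (br (E i) (E i3)) = - coord i2 (br (E i) (E i2))).

Local Notation c i j k := (coord k (br (E i) (E j))).
Let u k := c i2 i2 k.
Let v k := c i3 i3 k.
Let w k := c i2 i3 k.

Lemma bracket_coord_even (k : 'I_4) X Y : (k < 2)%N ->
  coord k (br X Y) =
    w k * (coord i2 X * coord i3 Y + coord i3 X * coord i2 Y)
    + u k * (coord i2 X * coord i2 Y)
    + v k * (coord i3 X * coord i3 Y).
Proof.
rewrite ltnS leqNgt => /negbTE k_even; rewrite /u /v /w.
have c_odd (i j : 'I_4) : (1 < i)%N (+) (1 < j)%N -> c i j k = 0.
  by move=> ij; rewrite bracket_parity // k_even ij.
have br10 : br (E i1) (E i0) = 0.
  by rewrite (bracket_basis_skew br_skew i0 i1) br_even_part scaler0 oppr0.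
have br32 : br (E i3) (E i2) = br (E i2) (E i3).
  by rewrite (bracket_basis_skew br_skew i2 i3) expr1 scaleN1r opprK.
rewrite (bilinear_basis _ _ br_bilin) !g22_sum !raddfD /= !coordZ.
rewrite br_even_part br10 br32 (bracket_even_diag br_skew (i := i0)) //.
rewrite (bracket_even_diag br_skew (i := i1)) // !raddf0.
rewrite (c_odd i0 i2) // (c_odd i0 i3) // (c_odd i1 i2) // (c_odd i1 i3) //.
rewrite (c_odd i2 i0) // (c_odd i3 i0) // (c_odd i2 i1) // (c_odd i3 i1) //.
ring.
Qed.

Lemma bracket_coord_odd (k : 'I_4) X Y : (1 < k)%N ->
  coord k (br X Y) =
      c i0 i2 k * (coord i0 X * coord i2 Y - coord i2 X * coord i0 Y)
    + c i0 i3 k * (coord i0 X * coord i3 Y - coord i3 X * coord i0 Y)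
    + c i1 i2 k * (coord i1 X * coord i2 Y - coord i2 X * coord i1 Y)
    + c i1 i3 k * (coord i1 X * coord i3 Y - coord i3 X * coord i1 Y).
Proof.
move=> k_odd.
have c_even (i j : 'I_4) : (1 < i)%N = (1 < j)%N -> c i j k = 0.
  by move=> ij; rewrite bracket_parity // k_odd ij addbb.
have c_skew (i j : 'I_4) : (i < 2)%N -> c j i k = - c i j k.
  rewrite ltnS leqNgt => /negbTE i_even.
  by rewrite (bracket_basis_skew br_skew i j) i_even expr0 scale1r raddfN.
rewrite (bilinear_basis _ _ br_bilin) !g22_sum !raddfD /= !coordZ.
rewrite (c_even i0 i0) // (c_even i1 i1) // (c_even i2 i2) // (c_even i3 i3) //.
rewrite (c_even i0 i1) // (c_even i1 i0) // (c_even i2 i3) // (c_even i3 i2) //.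
rewrite (c_skew i0 i2) // (c_skew i0 i3) // (c_skew i1 i2) // (c_skew i1 i3) //.
ring.
Qed.

Let p := c i1 i2 i2.
Let q := c i1 i2 i3.
Let r := c i1 i3 i2.
Let p' := c i0 i2 i2.
Let q' := c i0 i2 i3.
Let r' := c i0 i3 i2.
Let a := w i0.
Let d := w i1.

Lemma bracket_coord2 X Y : coord i2 (br X Y) =
      p' * (coord i0 X * coord i2 Y - coord i2 X * coord i0 Y)
    + r' * (coord i0 X * coord i3 Y - coord i3 X * coord i0 Y)
    + p * (coord i1 X * coord i2 Y - coord i2 X * coord i1 Y)
    + r * (coord i1 X * coord i3 Y - coord i3 X * coord i1 Y).
Proof. exact: bracket_coord_odd. Qed.

Lemma bracket_coord3 X Y : coord i3 (br X Y) =
      q' * (coord i0 X * coord i2 Y - coord i2 X * coord i0 Y)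
    - p' * (coord i0 X * coord i3 Y - coord i3 X * coord i0 Y)
    + q * (coord i1 X * coord i2 Y - coord i2 X * coord i1 Y)
    - p * (coord i1 X * coord i3 Y - coord i3 X * coord i1 Y).
Proof. by rewrite bracket_coord_odd // !br_trace // !mulNr. Qed.

(* The traceless operators ad E0 and ad E1 of the odd part commute because    *)
(* [E0, E1] = 0, so ad E0 is a multiple of ad E1, whose entry p is a unit.    *)
Lemma ad_proportional pi : p * pi = 1 ->
  [/\ p' = p' * pi * p, q' = p' * pi * q & r' = p' * pi * r].
Proof.
move=> p_pi.
(* The off-diagonal entries of the commutator of two traceless 2 x 2 matrices carry a factor 2. *)
have two (x y : A) : (x - y) *+ 2 = 0 -> x = y.
  by move=> /fps_natmulI/eqP; rewrite subr_eq0 => /eqP.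
have J2 := br_jacobi (gr_basis K i1) (gr_basis K i0) (gr_basis K i2).
have J3 := br_jacobi (gr_basis K i1) (gr_basis K i0) (gr_basis K i3).
have /(congr1 (coord i3)) := J2; have /(congr1 (coord i2)) := J3.
rewrite !raddfD /= !coordZ !(bracket_coord2, bracket_coord3).
rewrite !(@bracket_coord_even i0, @bracket_coord_even i1) // !coord_basis /=.
move=> Jr Jq.
have qE : p' * q = p * q'.
  apply: two; move/eqP: Jq; rewrite -subr_eq0 => /eqP <-; ring.
have rE : p' * r = p * r'.
  apply: two; move/esym/eqP: Jr; rewrite -subr_eq0 => /eqP <-; ring.
split; first by rewrite -mulrA (mulrC pi) p_pi mulr1.
  by rewrite mulrAC qE (mulrC p) -mulrA p_pi mulr1.
by rewrite mulrAC rE (mulrC p) -mulrA p_pi mulr1.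
Qed.

(** Since [E1, [E2, E2]] = 0, the Jacobi identity gives 2 [[E1, E2], E2] = 0, that is p [E2, E2] + q
    [E2, E3] = 0; the same with E3 gives [E3, E3]. *)
Lemma odd_squares pi (k : 'I_4) : p * pi = 1 -> (k < 2)%N ->
  u k = - (pi * q * w k) /\ v k = pi * r * w k.
Proof.
move=> p_pi k_even.
have two (x : A) : x *+ 2 = 0 -> x = 0 by exact: fps_natmulI.
have J2 := br_jacobi (gr_basis K i1) (gr_basis K i2) (gr_basis K i2).
have J3 := br_jacobi (gr_basis K i1) (gr_basis K i3) (gr_basis K i3).
have /(congr1 (coord k)) := J2; have /(congr1 (coord k)) := J3.
rewrite !raddfD /= !coordZ !(bracket_coord_even _ _ k_even).
rewrite !(bracket_coord2, bracket_coord3) !coord_basis /=.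
move=> Jv Ju.
have uE : p * u k = - (q * w k).
  apply/eqP; rewrite -addr_eq0; apply/eqP/two.
  move/esym/eqP: Ju; rewrite -subr_eq0 => /eqP <-; ring.
have vE : p * v k = r * w k.
  apply/eqP; rewrite -subr_eq0; apply/eqP/two.
  move/eqP: Jv; rewrite -subr_eq0 => /eqP <-; ring.
split.
  by rewrite -[LHS]mul1r -p_pi mulrAC uE mulNr mulrC mulrA.
by rewrite -[LHS]mul1r -p_pi mulrAC vE mulrC mulrA.
Qed.

(** This says that w = [E2, E3] equals a (E0 - rho E1) with rho = p' / p, hence is central. On the
    odd part ad w is (d + rho a) ad E1, and the Jacobi identity for E2, E2, E3 makes this factor
    vanish. *)
Lemma odd_bracket_central pi : p * pi = 1 -> d = - (p' * pi * a).
Proof.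
move=> p_pi; have [p'E q'E r'E] := ad_proportional p_pi.
have [u0 v0] := odd_squares (k := i0) p_pi isT.
have [u1 v1] := odd_squares (k := i1) p_pi isT.
have J := br_jacobi (gr_basis K i2) (gr_basis K i2) (gr_basis K i3).
have /(congr1 (coord i3)) := J; have /(congr1 (coord i2)) := J.
rewrite !raddfD /= !coordZ !(bracket_coord2, bracket_coord3) !coord_basis /=.
rewrite !(@bracket_coord_even i0, @bracket_coord_even i1) // !coord_basis /=.
rewrite u0 u1 -/a -/d p'E q'E r'E.
move: (p' * pi) => rho J2 J3.
(* The E3-coordinate gives 3 q (d + rho a) = 0; the E2-coordinate then gives 2 p (d + rho a) = 0. *)
have qk : q * (d + rho * a) = 0.
  apply: (@fps_natmulI K 2); move/esym/eqP: J3; rewrite -subr_eq0 => /eqP <-.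
  ring: p_pi.
have pk : p * (d + rho * a) = 0.
  apply: (@fps_natmulI K 1).
  transitivity (pi * r * (q * (d + rho * a))); last by rewrite qk mulr0.
  apply/eqP; rewrite -subr_eq0; apply/eqP.
  move/esym/eqP: J2; rewrite -subr_eq0 => /eqP <-; ring.
apply/eqP; rewrite -addr_eq0 -(mulrA rho) p_pi mulr1 -[_ + _]mul1r -p_pi mulrAC.
by rewrite pk mul0r.
Qed.

(** The matrix sends E2 and E3 to combinations that turn ad E1 into diag(l, -l), so E1 goes to l E1.
    The image of E0 is chosen so that the central w goes to a multiple of E0. *)
Lemma normalizing_map : p 0%N = 1 -> q 0%N = 0 -> r 0%N = 0 -> p' 0%N = 0 ->
  a 0%N = 1 -> exists N : nat -> 'M[K]_4,
  [/\ N 0%N = 1%:M,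
      forall n (i j : 'I_4), (1 < i)%N != (1 < j)%N -> N n i j = 0
    & forall X Y, let Psi := fps_linear (fun n x => x *m N n) in
        Psi (br X Y) =
        fps_bilinear (constant_deformation (@g22_br K)) (Psi X) (Psi Y)].
Proof.
move=> p0 q0 r0 p'0 a0.
have K2 : (2 : K) != 0 by rewrite pnatr_eq0.
have [pi p_pi pi0] := fps_inv_exists p0.
have [ai a_ai ai0] := fps_inv_exists a0.
have [l ll l0] : exists2 l, l * l = p * p + q * r & l 0%N = 1.
  apply: fps_sqrt_exists => //.
  by rewrite -[LHS]/((p * p) 0%N + (q * r) 0%N) !coef0_fpsM p0 q0 mul0r addr0 mulr1.
have [h hh h0] : exists2 h : A, h + h = 1 & h 0%N = 2^-1.
  exists (fpsC 2^-1) => //; apply/fpsP => -[|n] /=; last by rewrite addr0.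
  by rewrite -mulr2n -[LHS]mulr_natl mulfV.
have halve x : x = h * x + h * x by rewrite -mulrDl hh mul1r.
have [p'E q'E r'E] := ad_proportional p_pi.
have [u0E v0E] := odd_squares (k := i0) p_pi isT.
have [u1E v1E] := odd_squares (k := i1) p_pi isT.
have dE := odd_bracket_central p_pi.
(* The factor [al] is forced by the bracket of the images of E2 and E3, namely (s^2 - g k) E0 = p s
   E0, which has to equal a al E0. *)
pose rho := p' * pi; pose s := h * (p + l); pose t := h * (p - l).
pose g := h * q; pose k := h * r; pose al := ai * p * s.
have pE : p = s + t by rewrite [LHS]halve /s /t; ring.
have lE : l = s - t by rewrite [LHS]halve /s /t; ring.
have qE : q = g + g by exact: halve.
have rE : r = k + k by exact: halve.
have gk : g * k = - (s * t).
  rewrite /g /k /s /t; transitivity (h * h * (l * l - p * p)); last by ring.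
  by rewrite ll; ring.
have al_a : al * a = p * s by rewrite /al; ring: a_ai.
have al_u : al * u i0 = - (q * s) by rewrite u0E /al -/a; ring: a_ai p_pi.
have al_v : al * v i0 = r * s by rewrite v0E /al -/a; ring: a_ai p_pi.
(* Row i is the image of E_i. *)
pose P (i j : 'I_4) : A := match val i, val j with
  | 0, 0 => al | 0, 1 => rho * l | 1, 1 => l
  | 2, 2 => s | 2, 3 => - g | 3, 2 => k | 3, 3 => s | _, _ => 0 end.
pose N n := \matrix_(i, j) P i j n.
have PsiE i X : coord i (fps_linear (fun n x => x *m N n) X) =
    coord i0 X * P i0 i + coord i1 X * P i1 i + coord i2 X * P i2 i
    + coord i3 X * P i3 i.
  have NE j : Fps (fun n => N n j i) = P j i by apply/fpsP => n; rewrite /= mxE.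
  by rewrite fps_linearE g22_sum !NE.
exists N; split.
- have s0 : s 0%N = 1.
    by rewrite coef0_fpsM h0 -[(p + l) 0%N]/(p 0%N + l 0%N) p0 l0 mulVf.
  have al0 : al 0%N = 1 by rewrite 2!coef0_fpsM ai0 p0 s0 !mulr1.
  have rl0 : (rho * l) 0%N = 0 by rewrite !coef0_fpsM p'0 !mul0r.
  have g0 : (- g) 0%N = 0 by rewrite -[LHS]/(- g 0%N) coef0_fpsM q0 mulr0 oppr0.
  have k0 : k 0%N = 0 by rewrite coef0_fpsM r0 mulr0.
  apply/matrixP; apply: g22_ordP; apply: g22_ordP; rewrite !mxE //.
- by move=> n; apply: g22_ordP; apply: g22_ordP; rewrite // !mxE.
move=> X Y Psi; have [] := constant_bracket_coord (Psi X) (Psi Y).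
move=> Z0 Z1 Z2 Z3.
apply: coord_rowP; rewrite ?Z0 ?Z1 ?Z2 ?Z3 !PsiE /P /= !mulr0 ?addr0 ?add0r.
- rewrite bracket_coord_even // -/a.
  set x2 := coord i2 X; set x3 := coord i3 X; set y2 := coord i2 Y; set y3 := coord i3 Y.
  transitivity (al * a * (x2 * y3 + x3 * y2) + al * u i0 * (x2 * y2)
    + al * v i0 * (x3 * y3)); first by ring.
  by rewrite al_a al_u al_v pE qE rE; ring: gk.
- rewrite !bracket_coord_even // u0E u1E v0E v1E -/a -/d dE -/rho; ring.
- rewrite bracket_coord2 bracket_coord3 p'E q'E r'E -/rho pE qE rE lE; ring: gk.
- rewrite bracket_coord2 bracket_coord3 p'E q'E r'E -/rho pE qE rE lE; ring: gk.
Qed.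
End Bracket.
End Normalization.

(** * Triviality of metric deformations *)

Theorem theorem3p1p2 (R : realType)
    (phi : nat -> 'rV[R[i]]_4 -> 'rV[R[i]]_4 -> 'rV[R[i]]_4) :
  is_metric_deformation (@g22_gr R[i]) (@g22_br R[i]) phi ->
  trivial_deformation (@g22_gr R[i]) (@g22_br R[i]) phi.
Proof.
move=> [[phi0 _ _] [[_ br_bilin br_even br_skew br_jacobi]]].
move=> [B [B_bilin B_even B_sym B_inv B_nondeg]].
have coef0 (i j k : 'I_4) : coord k (fps_bilinear phi (basis _ i) (basis _ j)) 0%N =
    g22_br (delta_mx 0 i) (delta_mx 0 j) 0 k.
  by rewrite /= !big_ord_recl !big_ord0 !addr0 phi0.
have ab := even_part_abelian B_bilin B_even B_sym B_nondeg br_even br_skew B_inv.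
have tr := ad_even_traceless B_bilin B_even B_sym B_nondeg br_even br_skew B_inv.
(* The five side conditions are the structure constants at t = 0, read off from the undeformed
   bracket. *)
have [||||| N [N0 N_even N_morph]] :=
    normalizing_map br_bilin br_even br_skew br_jacobi ab tr;
  try by rewrite coef0 g22_brE !mxE /= ?mulr0 ?mul0r ?mulr1 ?subr0 ?oppr0 ?addr0.
exists (fun n x => x *m N n); split=> [|n|x y]; last exact: N_morph.
  by apply/funext => x; rewrite N0 mulmx1.
split=> [c x y|b x x_b i ib]; first by rewrite mulmxDl scalemxAl.
rewrite mxE big1 // => j _; have [jb|jb] := boolP ((1 < j)%N == b); last first.
  by rewrite (x_b j) ?mul0r.
by rewrite N_even ?mulr0 // (eqP jb) eq_sym.
Qed.
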